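(* Let $G$ be a (possibly uncountable) group and let $V$ be a finite-dimensional vector space over a field $\mathbb{K}$. Let $\tau \colon X \to V^G$ be a linear cellular automaton, where $X \subset V^G$ is a linear subshift of finite type. Then $\tau(X)$ is closed in $V^G$ for the prodiscrete topology and is therefore a linear subshift of $V^G$.
   Context: $V^G$ is the set of all maps (configurations) $x \colon G \to V$, with its product $\mathbb{K}$-vector space structure, the prodiscrete topology (product of the discrete topologies on the factors $V$), and the left $G$-action $(gx)(h) = x(g^{-1}h)$. A linear subshift is a closed $G$-invariant vector subspace of $V^G$. It is of finite type if there exist a finite subset $D \subset G$ and a subset $L \subset V^D$ such that $X = \{x \in V^G : (g^{-1}x)\vert_D \in L \text{ for all } g \in G\}$, where $\vert_D$ denotes restriction to $D$. A linear cellular automaton $\tau \colon X \to Y$ between linear subshifts $X,Y \subset V^G$ is a $\mathbb{K}$-linear map for which there exist a finite subset $M \subset G$ (a memory set) and a map $\mu \colon V^M \to V$ with $\tau(x)(g) = \mu((g^{-1}x)\vert_M)$ for all $x \in X$ and $g \in G$. *)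

(* Defs.v *)
From mathcomp Require Import all_boot all_algebra.
From mathcomp Require Import all_classical topology.

Set Implicit Arguments.
Unset Strict Implicit.
Unset Printing Implicit Defensive.

Import GRing.Theory.
Local Open Scope classical_set_scope.
Local Open Scope ring_scope.

(* [groupType] and [vectType K] are also choice types; this is no restriction,
   since every type is one by the classical axioms of [boolp]. *)

Section Configurations.
Variables (G : groupType) (K : fieldType) (V : vectType K).

(* The left action (g x)(h) = x (g^-1 h). *)
Definition shift (g : G) (x : G -> V) : G -> V := fun h => x (g^-1 * h)%g.

Definition prodiscrete_closed (X : set (G -> V)) : Prop :=
  closed (X : set {ptws G -> discrete_topology V}).

Definition linear_subshift (X : set (G -> V)) : Prop :=
  [/\ GRing.submod_closed [in X],
      forall (g : G) (x : G -> V), X x -> X (shift g x)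
    & prodiscrete_closed X].

(* For a set [D], [D -> V] is the type of functions on the subtype given by [D],
   and [sigL D x] is the restriction of [x] to [D]. *)
Definition finite_type (X : set (G -> V)) : Prop :=
  exists (D : set G) (L : set (D -> V)), finite_set D /\
    X = [set x | forall g : G, L (sigL D (shift g^-1%g x))].

(* A map X -> Y is given by a total function, of which only the values on [X]
   matter. *)
Definition linear_cellular_automaton (X Y : set (G -> V))
    (tau : (G -> V) -> (G -> V)) : Prop :=
  [/\ set_fun X Y tau,
      forall (a : K) (x y : G -> V), X x -> X y ->
        tau (a *: x + y) = a *: tau x + tau y
    & exists (M : set G) (mu : (M -> V) -> V), finite_set M /\
        forall (x : G -> V) (g : G), X x ->
          tau x g = mu (sigL M (shift g^-1%g x))].

End Configurations.

(* Main.v *)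
Require Import Defs.
From mathcomp Require Import all_boot all_algebra.
From mathcomp Require Import all_classical topology.

(** The proof is a linear compactness argument, in which finite dimensionality
    of [V] replaces finiteness of the alphabet.

    Let [y] be in the closure of [tau @` X]. For a finite [s], the
    configurations of [X] whose image agrees with [y] on [s] form a nonempty
    affine set, and these sets decrease as [s] grows; a preimage of [y] is a
    point common to all of them. Such a point is found in two steps.

    In [V], a downward directed family of nonempty affine sets has a common
    point, because a member of least dimension is contained in every other one
    ([directed_affine_meet]). In [G -> V], take by Zorn's lemma a maximal
    partial configuration all of whose finite parts extend inside each member of
    the family; the result on [V], applied to the values that these extensions take
    at a point, shows that it is defined everywhere
    ([linearly_compact_configurations]). The configuration obtained is thus in
    the closure of each member of the family. As [X] is closed and [tau] depends
    on finitely many coordinates at a time, it belongs to [X] and is mapped to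
    [y] ([closed_image_cellular_automaton]).

    Zorn's lemma allows [G] to be uncountable: over a countable group one could
    instead choose the values one coordinate after the other. *)

Local Open Scope classical_set_scope.

Import GRing.Theory.
Local Open Scope ring_scope.

(** * The prodiscrete topology by finite windows *)

Section Prodiscrete.
Context {G V : choiceType}.

Lemma nbhs_prodiscreteP (u : G -> V) (A : set (G -> V)) :
  nbhs (u : {ptws G -> discrete_topology V}) A <->
  exists s : seq G, [set x : G -> V | {in s, x =1 u}] `<=` A.
Proof.
split=> [|[s sA]].
  (* The inclusion of [nbhs u] in the cylinder filter [F] says that [F]
     converges to [u], which can be checked one coordinate at a time. *)
  pose F := [set B : set (G -> V) |
    exists s : seq G, [set x : G -> V | {in s, x =1 u}] `<=` B].
  have FF : Filter F.
    split; first by exists [::].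
      move=> B C [s sB] [t tC]; exists (s ++ t) => x xu.
      by split; [apply: sB|apply: tC] => g gs; apply: xu;
        rewrite mem_cat gs ?orbT.
    by move=> B C BC [s sB]; exists s; exact: subset_trans BC.
  apply: (@pointwise_cvgP (discrete_topology G) (discrete_topology V) F u FF).2.
  move=> g.
  apply/discrete_cvg.
  exists [:: g] => x /= xu; exact: (xu g (mem_head _ _)).
pose nbhs_u := nbhs (u : {ptws G -> discrete_topology V}).
have nbhs_uF : Filter nbhs_u by exact: nbhs_filter.
apply: (filterS sA).
elim: s {sA} => [|g s IHs]; first by apply: (filterS _ filterT) => x _ h.
have near_g : nbhs_u [set x : G -> V | x g = u g].
  exact: (@proj_continuous G (fun=> discrete_topology V) g u _
    (discrete_set1 (u g : discrete_topology V))).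
apply: (filterS _ (filterI near_g IHs)) => x [xg xs] h.
by rewrite inE => /predU1P[->//|]; exact: xs.
Qed.

End Prodiscrete.

Lemma prodiscrete_closedP {G : groupType} {K : fieldType} {V : vectType K}
    (X : set (G -> V)) :
  prodiscrete_closed X <->
  forall u : G -> V, (forall s : seq G, exists2 x, X x & {in s, x =1 u}) -> X u.
Proof.
split=> clX u uX.
  apply: clX => B /nbhs_prodiscreteP[s sB].
  by have [x Xx xu] := uX s; exists x; split=> //; exact: sB.
apply: clX => s.
have /uX[x [Xx xu]] : nbhs (u : {ptws G -> discrete_topology V})
    [set x : G -> V | {in s, x =1 u}] by apply/nbhs_prodiscreteP; exists s.
by exists x.
Qed.

(** * Affine sets and linear compactness *)

(** Affine sets are described without a base point. Three points are needed:
    over the field with two elements, stability under [a *: x + (1 - a) *: z]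
    is a void condition. *)
Definition affine_set {K : fieldType} {W : lmodType K} (A : set W) : Prop :=
  forall (a : K) x y z, A x -> A y -> A z -> A (a *: (x - y) + z).

Definition directed_down {T : Type} (F : set (set T)) : Prop :=
  forall A B, F A -> F B -> exists2 C, F C & C `<=` A `&` B.

Section FiniteDimension.
Context {K : fieldType} {V : vectType K}.

(** A subspace of greatest dimension inside [S] must be [S], since any vector of
    [S] outside it could be adjoined. *)
Lemma submod_closed_vspace (S : set V) :
  GRing.submod_closed [in S] -> exists W : {vspace V}, S = [set` W].
Proof.
move=> [/set_mem S0 Slin].
have SL a u v : S u -> S v -> S (a *: u + v).
  by move=> Su Sv; apply/set_mem/Slin; exact/mem_set.
pose P n := `[< exists2 W : {vspace V}, \dim W = n & [set` W] `<=` S >].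
have P0 : exists n, P n.
  exists 0%N; apply/asboolP; exists 0%VS; first exact: dimv0.
  by move=> v /=; rewrite memv0 => /eqP->.
have Pmax n : P n -> (n <= \dim {:V})%N.
  by move=> /asboolP[W <- _]; exact/dimvS/subvf.
case: (ex_maxnP P0 Pmax) => n /asboolP[W dimW WS] maxn.
exists W; apply/seteqP; split=> // s Ss /=.
have /maxn : P (\dim (W + <[s]>)%VS).
  apply/asboolP; exists (W + <[s]>)%VS => // v /= /memv_addP[w Ww].
  by move=> [_ /vlineP[a ->] ->]; rewrite addrC; apply: SL => //; exact: WS.
rewrite -dimW => dimle.
have /eqP-> : W == (W + <[s]>)%VS by rewrite eqEdim addvSl.
exact: subvP (addvSr _ _) _ (memv_line s).
Qed.

(** The direction space gives an affine set a dimension to minimize. *)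
Lemma affine_set_direction (A : set V) : affine_set A -> A !=set0 ->
  exists W : {vspace V}, forall x y, A x -> A y <-> y - x \in W.
Proof.
move=> affA [p Ap].
have [|W WE] := @submod_closed_vspace [set v | A (v + p)].
  split; first by apply/mem_set; rewrite /= add0r.
  move=> a v w /set_mem/= Av /set_mem/= Aw; apply/mem_set => /=.
  by have := affA a _ _ _ Av Ap Aw; rewrite addrK addrA.
have inW v : v \in W <-> A (v + p).
  by have := congr1 (@^~ v) WE => /= ->.
exists W => x y Ax; rewrite inW; split => [Ay|].
  by have := affA 1 _ _ _ Ay Ax Ap; rewrite scale1r.
by move=> /(affA 1 _ p x)/(_ Ap Ax); rewrite addrK scale1r subrK.
Qed.

(** A member [B] of least dimension lies in every member [C]: some [D] in the
    family lies in both, its direction is contained in that of [B] and has at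
    least its dimension, hence [D] is all of [B]. *)
Lemma directed_affine_meet (F : set (set V)) :
  F !=set0 -> directed_down F -> (forall B, F B -> affine_set B) ->
  (forall B, F B -> B !=set0) -> exists v, forall B, F B -> B v.
Proof.
move=> [B0 FB0] dirF affF neF.
pose P n := `[< exists (B : set V) (W : {vspace V}), [/\ F B, \dim W = n &
  forall x y, B x -> B y <-> y - x \in W] >].
have P_of B (W : {vspace V}) : F B ->
    (forall x y, B x -> B y <-> y - x \in W) -> P (\dim W).
  by move=> FB BW; apply/asboolP; exists B, W.
have P0 : exists n, P n.
  have [W BW] := affine_set_direction B0 (affF _ FB0) (neF _ FB0).
  by exists (\dim W); exact: P_of BW.
case: (ex_minnP P0) => n /asboolP[B [W [FB dimW BW]]] minn.
have [v Bv] := neF _ FB; exists v => C FC.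
have [D FD DBC] := dirF _ _ FB FC.
have [d Dd] := neF _ FD; have [Bd Cd] := DBC _ Dd.
have [W' DW'] := affine_set_direction D (affF _ FD) (neF _ FD).
have W'W : (W' <= W)%VS.
  apply/subvP => w Ww; rewrite -(addrK d w); apply/(BW _ _ Bd).
  by apply: (DBC _ _).1; apply/(DW' _ _ Dd); rewrite addrK.
have eqW : W' = W.
  by apply/eqP; rewrite eqEdim W'W dimW; apply: minn; exact: P_of DW'.
by apply: (DBC _ _).2; apply/(DW' _ _ Dd); rewrite eqW; exact/(BW _ _ Bd).
Qed.

End FiniteDimension.

(** This is what makes a condition on finite parts pass to unions of chains. *)
Lemma chain_seq_sub {T : eqType} (F : set (set T)) (t : seq T) :
  total_on F subset -> F !=set0 ->
  {in t, forall p, (\bigcup_(U in F) U) p} ->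
  exists2 U, F U & {in t, forall p, U p}.
Proof.
move=> totF [U0 FU0]; elim: t => [_|p t IHt tF]; first by exists U0.
have [|U FU Ut] := IHt; first by move=> q qt; apply: tF; rewrite inE qt orbT.
have [U' FU' U'p] : (\bigcup_(U in F) U) p by apply: tF; rewrite mem_head.
have [UU'|U'U] := totF _ _ FU FU'.
  exists U' => // q; rewrite inE => /predU1P[->//|/Ut]; exact: UU'.
by exists U => // q; rewrite inE => /predU1P[->|/Ut//]; exact: U'U.
Qed.

(** Partial configurations are handled as sets of pairs [(g, v)]: by the
    condition [P] below, two pairs of such a set with the same [g] have the same
    [v], as they are taken by a common total configuration. *)
Lemma linearly_compact_configurations {G : choiceType} {K : fieldType}
    {V : vectType K} (F : set (set (G -> V))) :
  F !=set0 -> directed_down F -> (forall A, F A -> affine_set A) ->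
  (forall A, F A -> A !=set0) ->
  exists u : G -> V, forall A (s : seq G), F A ->
    exists2 x, A x & {in s, x =1 u}.
Proof.
move=> [A0 FA0] dirF affF neF.
pose agree (t : seq (G * V)) (x : G -> V) := {in t, forall p, x p.1 = p.2}.
pose P (U : set (G * V)) := forall A t, F A -> {in t, forall p, U p} ->
  exists2 x, A x & agree t x.
have [|U [PU maxU]] := @Zorn_bigcup _ P.
  move=> C CP totC A t FA tC.
  have [C0|/set0P C0] := eqVneq C set0.
    by have [x Ax] := neF _ FA; exists x => // p /tC; rewrite C0 => -[].
  have [U CU tU] := chain_seq_sub C t totC C0 tC.
  exact: CP CU _ _ FA tU.
(* To extend [U] at [g], a value is needed that is compatible with every member
   of [F] and every finite part of [U] simultaneously. *)
pose vals g := [set B : set V | exists A t, [/\ F A, {in t, forall p, U p} &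
  B = [set x g | x in A `&` agree t]]].
have Utotal g : exists v, U (g, v).
  have [||B [A [t [FA tU ->]]]|B [A [t [FA tU ->]]]|v valsv] :=
      @directed_affine_meet _ _ (vals g).
  - by exists [set x g | x in A0 `&` agree [::]], A0, [::].
  - move=> _ _ [A [s [FA sU ->]]] [B [t [FB tU ->]]].
    have [C FC CAB] := dirF _ _ FA FB.
    exists [set x g | x in C `&` agree (s ++ t)].
      exists C, (s ++ t); split=> // p.
      by rewrite mem_cat => /orP[]; [exact: sU|exact: tU].
    move=> _ [x [/CAB[Ax Bx] xst] <-]; split; exists x => //; split=> // p pst;
      by apply: xst; rewrite mem_cat pst ?orbT.
  - move=> a _ _ _ [x [Ax xt] <-] [y [Ay yt] <-] [z [Az zt] <-].
    exists (a *: (x - y) + z); last by [].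
    split; first exact: affF.
    move=> p pt; transitivity (a *: (x p.1 - y p.1) + z p.1); first by [].
    by rewrite xt// yt// zt// subrr scaler0 add0r.
  - by have [x Ax xt] := PU _ _ FA tU; exists (x g), x.
  exists v; apply: contrapT => nUv; apply: (maxU (U `|` [set (g, v)])).
    by split=> [p|/(_ (g, v)) sub]; [left | apply/nUv/sub; right].
  move=> A t FA tU; pose t' := [seq p <- t | p != (g, v)].
  have t'U : {in t', forall p, U p}.
    by move=> p; rewrite mem_filter => /andP[/eqP pgv /tU[|/pgv]].
  have [|x [Ax xt'] xgv] := valsv [set x g | x in A `&` agree t'].
    by exists A, t'.
  exists x => // p pt; have [->//|pgv] := eqVneq p (g, v).
  by apply: xt'; rewrite mem_filter pgv.
have [u Uu] := choice Utotal; exists u => A s FA.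
have [|x Ax xs] := PU A [seq (g, u g) | g <- s] FA.
  by move=> _ /mapP[g _ ->].
by exists x => // g gs; apply: (xs (g, u g)); exact: map_f.
Qed.

(** * Images of linear cellular automata *)

(** Linear compactness applies to the sets [fib s], which are affine because
    [tau] is linear, and nonempty because [y] is in the closure of the image. It
    yields only a point [x] in the closure of each of them; that [x] is in [X]
    and is sent to [y] comes from the closedness of [X] and the continuity of
    [tau]. *)
Lemma closed_image_cellular_automaton {G : groupType} {K : fieldType}
    {V : vectType K} (X : set (G -> V)) (tau : (G -> V) -> (G -> V)) :
  linear_subshift X -> linear_cellular_automaton X [set: G -> V] tau ->
  prodiscrete_closed (tau @` X).
Proof.
move=> [[_ Xlin] _ /prodiscrete_closedP Xclosed].
move=> [_ taulin [M [mu [/finite_seqP[m ME] tauE]]]].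
have XL a x y : X x -> X y -> X (a *: x + y).
  by move=> Xx Xy; apply/set_mem/Xlin; exact/mem_set.
have XB x y : X x -> X y -> X (x - y).
  by move=> Xx Xy; rewrite addrC -scaleN1r; exact: XL.
have tauB x y : X x -> X y -> tau (x - y) = tau x - tau y.
  by move=> Xx Xy; rewrite addrC -scaleN1r taulin// scaleN1r addrC.
apply/prodiscrete_closedP => y ycl.
pose fib (s : seq G) := [set x | X x /\ {in s, tau x =1 y}].
have [||_ [s _ <-]|_ [s _ <-]|x xcl] :=
    @linearly_compact_configurations _ _ _ (range fib).
- by exists (fib [::]), [::].
- move=> _ _ [s _ <-] [t _ <-]; exists (fib (s ++ t)); first by exists (s ++ t).
  by move=> x [Xx xst]; split; split=> // g gst; apply: xst;
    rewrite mem_cat gst ?orbT.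
- move=> a x1 x2 x3 [X1 y1] [X2 y2] [X3 y3]; split; first exact/XL/X3/XB.
  move=> g gs; rewrite taulin ?tauB//; last exact: XB.
  transitivity (a *: (tau x1 g - tau x2 g) + tau x3 g); first by [].
  by rewrite y1// y2// y3// subrr scaler0 add0r.
- by have [_ [x Xx <-] xy] := ycl s; exists x.
have Xx : X x.
  apply: Xclosed => s; have [|z [Xz _] zx] := xcl (fib [::]) s.
    by exists [::].
  by exists z.
exists x => //; apply/funext => g.
(* On the window [g M], [x] agrees with a configuration [z] for which
   [tau z g = y g]; the local rule sees no more than that window. *)
have [|z [Xz zy] zx] := xcl (fib [:: g]) [seq (g * k)%g | k <- m].
  by exists [:: g].
rewrite -zy ?mem_head// !tauE//; congr mu; apply/funext => -[k kM].
have km : k \in m by move: (kM); rewrite ME inE.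
by rewrite /sigL /= /shift /= invgK zx// map_f.
Qed.

Theorem theorem5p3 (G : groupType) (K : fieldType) (V : vectType K)
    (X : set (G -> V)) (tau : (G -> V) -> (G -> V))
    (hX : linear_subshift X) (hXft : finite_type X)
    (htau : linear_cellular_automaton X [set: G -> V] tau) :
  prodiscrete_closed (tau @` X) /\ linear_subshift (tau @` X).
Proof.
have tauXcl := closed_image_cellular_automaton X tau hX htau.
split=> //; have [[/set_mem X0 Xlin] Xshift _] := hX.
have [_ taulin [M [mu [_ tauE]]]] := htau.
split=> //.
- split.
    apply/mem_set; exists 0 => //.
    by have := taulin (-1) _ _ X0 X0; rewrite !scaleN1r !addNr.
  move=> a _ _ /set_mem[x Xx <-] /set_mem[y Xy <-]; apply/mem_set.
  exists (a *: x + y); last exact: taulin.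
  by apply/set_mem/Xlin; exact/mem_set.
move=> g _ [x Xx <-]; exists (shift g x); first exact: Xshift.
apply/funext => h; rewrite /shift tauE//; last exact: Xshift.
rewrite tauE//; congr mu; apply/funext => k.
by rewrite /sigL /= /shift !invgM !invgK mulgA.
Qed.
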